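(* Let $\{P_n\}_{n\ge 0}$ be a Laguerre–Hahn monic orthogonal polynomial sequence, with $\Phi$ and the polynomials $G_{0,k},G_{1,k},H_k,M_{j,k}$ as in the context. Then for every $n\ge0$, $$\mathcal{A}(x;n)P^{(4)}_{n+1}(x)+\mathcal{B}(x;n)P^{(3)}_{n+1}(x)+\mathcal{C}(x;n)P''_{n+1}(x)+\mathcal{D}(x;n)P'_{n+1}(x)+\mathcal{E}(x;n)P_{n+1}(x)=0,$$ where (omitting arguments) $$\mathcal A=\Phi^4\Delta_4,\qquad \mathcal B=M_{3,4}\Delta_4-\Phi^3\Delta_3,\qquad \mathcal C=M_{2,4}\Delta_4-M_{2,3}\Delta_3+\Phi^2\Delta_2,$$ $$\mathcal D=M_{1,4}\Delta_4-M_{1,3}\Delta_3+M_{1,2}\Delta_2-\Phi\Delta_1,$$ $$\mathcal E=M_{0,4}\Delta_4-M_{0,3}\Delta_3+M_{0,2}\Delta_2-M_{0,1}\Delta_1,$$ and $$\Delta_4=G_{0,1}(G_{1,2}H_3-G_{1,3}H_2)-G_{1,1}(G_{0,2}H_3-G_{0,3}H_2)+H_1(G_{0,2}G_{1,3}-G_{0,3}G_{1,2}),$$ $$\Delta_3=G_{0,1}(G_{1,2}H_4-G_{1,4}H_2)-G_{1,1}(G_{0,2}H_4-G_{0,4}H_2)+H_1(G_{0,2}G_{1,4}-G_{0,4}G_{1,2}),$$ $$\Delta_2=G_{0,1}(G_{1,3}H_4-G_{1,4}H_3)-G_{1,1}(G_{0,3}H_4-G_{0,4}H_3)+H_1(G_{0,3}G_{1,4}-G_{0,4}G_{1,3}),$$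 $$\Delta_1=G_{0,2}(G_{1,3}H_4-G_{1,4}H_3)-G_{1,2}(G_{0,3}H_4-G_{0,4}H_3)+H_2(G_{0,3}G_{1,4}-G_{0,4}G_{1,3}).$$
   Context: A form $u$ is a linear functional on the space of complex polynomials, with moments $(u)_n=\langle u,x^n\rangle$. It is regular, with monic orthogonal polynomial sequence (MOPS) $\{P_n\}_{n\ge0}$, if $P_n$ is monic of degree $n$ and $\langle u,P_nP_m\rangle=r_n\delta_{n,m}$ with all $r_n\neq0$. Forms are normalized: $(u)_0=1$. A MOPS satisfies $P_0=1$, $P_1=x-\beta_0$, $P_{n+2}=(x-\beta_{n+1})P_{n+1}-\gamma_{n+1}P_n$ ($n\ge0$), with $\beta_n\in\mathbb C$, $\gamma_{n+1}\in\mathbb C\setminus\{0\}$. $P_{n+1}^{(3)},P_{n+1}^{(4)}$ denote third and fourth derivatives. The formal Stieltjes function of $u$ is $S(u)(z)=-\sum_{n\ge0}(u)_n z^{-n-1}$. The regular form $u$ (and its MOPS) is Laguerre–Hahn if there are polynomials $\Phi,B,C,D$, with $\Phi$ monic (in particular nonzero), such that, as formal series in $1/z$, $\Phi(z)S'(u)(z)=B(z)S(u)(z)^2+C(z)S(u)(z)+D(z)$. Fix such polynomials. Define polynomials $C_n,D_n$ by $B_0=B$, $C_0=C$, $D_0=D$, $D_{-1}=B$, $\gamma_0=1$, and for $n\ge0$: $C_{n+1}(x)=-C_n(x)+2(x-\beta_n)D_n(x)$, $\gamma_{n+1}D_{n+1}(x)=-\Phi(x)+\gamma_nD_{n-1}(x)-(x-\beta_n)C_n(x)+(x-\beta_n)^2D_n(x)$.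 For $n\ge0$ define the following polynomials in $x$ depending on $n$ (arguments omitted, primes are $d/dx$): $G_{0,1}=0$, $G_{1,1}=B_0$, $H_1=-\gamma_{n+1}D_{n+1}$; $G_{0,2}=-2\gamma_{n+1}B_0D_{n+1}$, $G_{1,2}=\tfrac12(C_{n+1}+C_0)B_0+\Phi B_0'$, $H_2=\gamma_{n+1}\{\tfrac12(C_{n+1}+C_0)D_{n+1}-\Phi D_{n+1}'\}$; $G_{0,3}=\gamma_{n+1}\{D_{n+1}(C_{n+1}-C_0)B_0-3\Phi(B_0D_{n+1})'\}$, $G_{1,3}=B_0\{\tfrac14(C_{n+1}+C_0)^2-2\gamma_{n+1}D_nD_{n+1}+\tfrac12\Phi(C_{n+1}+C_0)'\}+\Phi B_0'\{C_{n+1}+C_0+\Phi'\}+\Phi^2B_0''$, $H_3=\gamma_{n+1}\{2B_0D_0+\tfrac12(C_{n+1}+C_0)'\Phi-\tfrac14(C_{n+1}+C_0)^2\}D_{n+1}+\gamma_{n+1}\Phi(C_{n+1}+C_0-\Phi')D_{n+1}'-\gamma_{n+1}\Phi^2D_{n+1}''$; $G_{0,4}=-\tfrac12(C_{n+1}-C_0)G_{0,3}-\gamma_{n+1}D_{n+1}G_{1,3}+B_0H_3+\Phi G_{0,3}'$, $G_{1,4}=D_nG_{0,3}+\tfrac12(C_{n+1}+C_0)G_{1,3}+\Phi G_{1,3}'$, $H_4=-D_0G_{0,3}-\tfrac12(C_{n+1}+C_0)H_3+\Phi H_3'$; $M_{0,1}=-\tfrac12(C_{n+1}-C_0)$; $M_{1,2}=\Phi(\Phi'+M_{0,1})$,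 $M_{0,2}=\Phi M_{0,1}'+B_0D_0+\gamma_{n+1}D_nD_{n+1}$; $M_{2,3}=\Phi(M_{1,2}+2\Phi\Phi')$, $M_{1,3}=\Phi(M_{0,2}+M_{1,2}')$, $M_{0,3}=\Phi M_{0,2}'+D_0G_{1,2}-D_nH_2$; $M_{3,4}=\Phi\{M_{2,3}+3\Phi^2\Phi'\}$, $M_{2,4}=\Phi\{M_{2,3}'+M_{1,3}\}$, $M_{1,4}=\Phi\{M_{1,3}'+M_{0,3}\}$, $M_{0,4}=\Phi M_{0,3}'+D_0G_{1,3}-D_nH_3$. *)

(* Defs.v *)
From HB Require Import structures.
From mathcomp Require Import all_boot all_order all_algebra.
From mathcomp Require Import boolp classical_sets functions cardinality fsbigop reals.
From mathcomp.real_closed Require Import complex.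

Set Implicit Arguments.
Unset Strict Implicit.
Unset Printing Implicit Defensive.

Import Order.TTheory GRing.Theory Num.Theory.
Local Open Scope ring_scope.

(* The MOPS of the form u; u is regular when such a P exists. *)
Definition is_MOPS (K : fieldType) (u : {scalar {poly K}})
    (P : nat -> {poly K}) : Prop :=
  (forall n, P n \is monic /\ size (P n) = n.+1) /\
  exists r : nat -> K,
    (forall n, r n != 0) /\ forall n m, u (P n * P m) = r n *+ (n == m).

(* Only the values gamma (n.+1) are recurrence coefficients; gamma 0 = 1 is a
   convention. *)
Definition recurrence_coefs (K : fieldType) (P : nat -> {poly K})
    (beta gamma : nat -> K) : Prop :=
  [/\ P 0%N = 1,
      P 1%N = 'X - (beta 0%N)%:P,
      forall n, P n.+2 = ('X - (beta n.+1)%:P) * P n.+1 - gamma n.+1 *: P n,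
      gamma 0%N = 1
    & forall n, gamma n.+1 != 0].

(* A formal Laurent series in 1/z: f k is the coefficient of z^k.  The
   exponents are meant to be bounded above. *)
Definition lseries (K : fieldType) := int -> K.

Definition lseries_add (K : fieldType) (f g : lseries K) : lseries K :=
  fun k => f k + g k.

(* For f and g with exponents bounded above, each of these sums has finite
   support (a sum with infinite support would be 0 by convention). *)
Definition lseries_mul (K : fieldType) (f g : lseries K) : lseries K :=
  fun k => \sum_(i \in [set: int]%classic) f i * g (k - i).

Definition lseries_deriv (K : fieldType) (f : lseries K) : lseries K :=
  fun k => (k + 1)%:~R * f (k + 1).

Definition lseries_poly (K : fieldType) (p : {poly K}) : lseries K :=
  fun k => match k with Posz n => p`_n | Negz _ => 0 end.

(* Negz n is the exponent -(n+1). *)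
Definition stieltjes (K : fieldType) (u : {scalar {poly K}}) : lseries K :=
  fun k => match k with Posz _ => 0 | Negz n => - u 'X^n end.

Definition stieltjes_riccati (K : fieldType) (u : {scalar {poly K}})
    (Phi B C D : {poly K}) : Prop :=
  let S := stieltjes u in
  lseries_mul (lseries_poly Phi) (lseries_deriv S) =1
  lseries_add
    (lseries_add (lseries_mul (lseries_poly B) (lseries_mul S S))
                 (lseries_mul (lseries_poly C) S))
    (lseries_poly D).

(* The series equation with B0, C0, D0 for B, C, D, and the recurrence
   coefficients of the MOPS. *)
Record LH_data (K : fieldType) := LHData {
  Phi : {poly K};
  B0 : {poly K};
  C0 : {poly K};
  D0 : {poly K};
  beta : nat -> K;
  gamma : nat -> K
}.

(* The triple (C_n, D_n, D_{n-1}), with D_{-1} = B_0.  The relation defining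
   D_{n+1} is divided by gamma_{n+1}, which is nonzero. *)
Fixpoint CDD (K : fieldType) (d : LH_data K) (n : nat) :
    {poly K} * {poly K} * {poly K} :=
  if n is m.+1 then
    let: (Cm, Dm, Dm1) := CDD d m in
    let xb := 'X - (beta d m)%:P in
    (- Cm + 2 *: (xb * Dm),
     (gamma d m.+1)^-1 *:
       (- Phi d + gamma d m *: Dm1 - xb * Cm + xb ^+ 2 * Dm),
     Dm)
  else (C0 d, D0 d, B0 d).

Definition Cseq (K : fieldType) (d : LH_data K) (n : nat) : {poly K} :=
  (CDD d n).1.1.
Definition Dseq (K : fieldType) (d : LH_data K) (n : nat) : {poly K} :=
  (CDD d n).1.2.

Section Coefficients.
Context (K : fieldType) (d : LH_data K) (n : nat).

Local Notation Phi := (Phi d).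
Local Notation B0 := (B0 d).
Local Notation C0 := (C0 d).
Local Notation D0 := (D0 d).
Local Notation g := (gamma d n.+1).
Local Notation Cn1 := (Cseq d n.+1).
Local Notation Dn := (Dseq d n).
Local Notation Dn1 := (Dseq d n.+1).

Definition G01 : {poly K} := 0.
Definition G11 : {poly K} := B0.
Definition H1 : {poly K} := - (g *: Dn1).

Definition G02 : {poly K} := - ((2 * g) *: (B0 * Dn1)).
Definition G12 : {poly K} := 2^-1 *: ((Cn1 + C0) * B0) + Phi * B0^`().
Definition H2 : {poly K} := g *: (2^-1 *: ((Cn1 + C0) * Dn1) - Phi * Dn1^`()).

Definition G03 : {poly K} :=
  g *: (Dn1 * (Cn1 - C0) * B0 - 3 *: (Phi * (B0 * Dn1)^`())).
Definition G13 : {poly K} :=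
  B0 * (4^-1 *: (Cn1 + C0) ^+ 2 - (2 * g) *: (Dn * Dn1)
        + 2^-1 *: (Phi * (Cn1 + C0)^`()))
  + Phi * B0^`() * (Cn1 + C0 + Phi^`())
  + Phi ^+ 2 * B0^`(2).
Definition H3 : {poly K} :=
  g *: ((2 *: (B0 * D0) + 2^-1 *: ((Cn1 + C0)^`() * Phi)
         - 4^-1 *: (Cn1 + C0) ^+ 2) * Dn1)
  + g *: (Phi * (Cn1 + C0 - Phi^`()) * Dn1^`())
  - g *: (Phi ^+ 2 * Dn1^`(2)).

Definition G04 : {poly K} :=
  - (2^-1 *: ((Cn1 - C0) * G03)) - g *: (Dn1 * G13) + B0 * H3 + Phi * G03^`().
Definition G14 : {poly K} :=
  Dn * G03 + 2^-1 *: ((Cn1 + C0) * G13) + Phi * G13^`().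
Definition H4 : {poly K} :=
  - (D0 * G03) - 2^-1 *: ((Cn1 + C0) * H3) + Phi * H3^`().

Definition M01 : {poly K} := - (2^-1 *: (Cn1 - C0)).

Definition M12 : {poly K} := Phi * (Phi^`() + M01).
Definition M02 : {poly K} := Phi * M01^`() + B0 * D0 + g *: (Dn * Dn1).

Definition M23 : {poly K} := Phi * (M12 + 2 *: (Phi * Phi^`())).
Definition M13 : {poly K} := Phi * (M02 + M12^`()).
Definition M03 : {poly K} := Phi * M02^`() + D0 * G12 - Dn * H2.

Definition M34 : {poly K} := Phi * (M23 + 3 *: (Phi ^+ 2 * Phi^`())).
Definition M24 : {poly K} := Phi * (M23^`() + M13).
Definition M14 : {poly K} := Phi * (M13^`() + M03).
Definition M04 : {poly K} := Phi * M03^`() + D0 * G13 - Dn * H3.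

Definition Delta4 : {poly K} :=
  G01 * (G12 * H3 - G13 * H2) - G11 * (G02 * H3 - G03 * H2)
  + H1 * (G02 * G13 - G03 * G12).
Definition Delta3 : {poly K} :=
  G01 * (G12 * H4 - G14 * H2) - G11 * (G02 * H4 - G04 * H2)
  + H1 * (G02 * G14 - G04 * G12).
Definition Delta2 : {poly K} :=
  G01 * (G13 * H4 - G14 * H3) - G11 * (G03 * H4 - G04 * H3)
  + H1 * (G03 * G14 - G04 * G13).
Definition Delta1 : {poly K} :=
  G02 * (G13 * H4 - G14 * H3) - G12 * (G03 * H4 - G04 * H3)
  + H2 * (G03 * G14 - G04 * G13).

Definition odeA : {poly K} := Phi ^+ 4 * Delta4.
Definition odeB : {poly K} := M34 * Delta4 - Phi ^+ 3 * Delta3.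
Definition odeC : {poly K} := M24 * Delta4 - M23 * Delta3 + Phi ^+ 2 * Delta2.
Definition odeD : {poly K} :=
  M14 * Delta4 - M13 * Delta3 + M12 * Delta2 - Phi * Delta1.
Definition odeE : {poly K} :=
  M04 * Delta4 - M03 * Delta3 + M02 * Delta2 - M01 * Delta1.

End Coefficients.

(* Main.v *)
Require Import Defs.
From HB Require Import structures.
From mathcomp Require Import all_boot all_order all_algebra.
From mathcomp Require Import reals.
From mathcomp.real_closed Require Import complex.
From mathcomp Require Import ring.

(** With Q n the associated polynomial of degree n - 1 (so Q n is the paper's
    P^(1)_(n-1)), the recurrences alone give a first-order linear system over
    P (n+1), P n, Q (n+1), Q n with coefficients built from C_n, D_n, B_0, C_0,
    D_0.  Applying Phi * d/dx repeatedly to the equation for P (n+1) produces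
    four relations whose left-hand sides, with coefficients M, are
    differential operators in P (n+1), and whose right-hand sides are
    G_(0,k) Q n + G_(1,k) Q (n+1) + H_k P n.  The 3 x 3 minors of these four
    right-hand sides eliminate Q n, Q (n+1) and P n. *)

Import Order.TTheory GRing.Theory Num.Theory.
Local Open Scope ring_scope.

(** Consecutive terms are carried as a pair, which makes the two-step recurrence structural. It is
    the recurrence of P, started from 0 and 1. *)
Fixpoint assoc_pair {K : fieldType} (beta gamma : nat -> K) (n : nat) :
    {poly K} * {poly K} :=
  if n is m.+1 then
    let: (q, q1) := assoc_pair beta gamma m in
    (q1, ('X - (beta m.+1)%:P) * q1 - gamma m.+1 *: q)
  else (0, 1).

Definition assoc {K : fieldType} (beta gamma : nat -> K) (n : nat) : {poly K} :=
  (assoc_pair beta gamma n).1.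

Lemma assocSS {K : fieldType} (beta gamma : nat -> K) (n : nat) :
  assoc beta gamma n.+2 =
  ('X - (beta n.+1)%:P) * assoc beta gamma n.+1
  - gamma n.+1 *: assoc beta gamma n.
Proof.
have E m : (assoc_pair beta gamma m).2 = (assoc_pair beta gamma m.+1).1.
  by rewrite /=; case: assoc_pair.
by rewrite /assoc -E /=; case: (assoc_pair beta gamma n).
Qed.

(** * First-order structure relations and their consequences *)

Section StructureRelation.
Variables (K : fieldType) (d : LH_data K) (P : nat -> {poly K}).
Hypothesis two_neq0 : 2 != 0 :> K.
Hypothesis P_rec : recurrence_coefs P (beta d) (gamma d).

Local Notation Q := (assoc (beta d) (gamma d)).
Local Notation g n := ((gamma d n)%:P).

(* With this mean, (C_n - C_0) / 2 is [Cmean n - C0 d]: no halves remain. *)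
Definition Cmean (n : nat) : {poly K} := 2^-1 *: (Cseq d n + C0 d).

Lemma scale_half_double (p : {poly K}) : 2^-1 *: (2 * p) = p.
Proof. by rewrite mulr_natl -scaler_nat scalerA mulVf ?scale1r. Qed.

Lemma Cseq_Cmean (n : nat) : Cseq d n = 2 * Cmean n - C0 d.
Proof. by rewrite /Cmean -scalerAr scale_half_double addrK. Qed.

Lemma Cmean0 : Cmean 0 = C0 d.
Proof. by rewrite -[RHS]scale_half_double mulr_natl. Qed.

Lemma CmeanS (n : nat) :
  Cmean n.+1 = C0 d - Cmean n + ('X - (beta d n)%:P) * Dseq d n.
Proof.
have CS : Cseq d n.+1 = - Cseq d n + 2 * (('X - (beta d n)%:P) * Dseq d n).
  rewrite /Cseq /Dseq /=; case: (CDD d n) => [[Cn Dn] Dm1] /=.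
  by rewrite scaler_nat mulr_natl.
rewrite -[RHS]scale_half_double {1}/Cmean CS; congr (_ *: _).
by rewrite Cseq_Cmean; ring.
Qed.

(** The case n = 0 stands apart because it involves D_(-1) = B_0 and gamma_0 = 1, whereas [Dseq]
    starts at D_0. *)
Lemma gamma_Dseq1 :
  g 1 * Dseq d 1 =
  - Phi d + B0 d - ('X - (beta d 0)%:P) * C0 d
  + ('X - (beta d 0)%:P) ^+ 2 * D0 d.
Proof.
have [_ _ _ g0 g_neq0] := P_rec.
by rewrite /Dseq /= g0 scale1r mul_polyC scalerA mulfV ?scale1r.
Qed.

Lemma gamma_DseqSS (n : nat) :
  g n.+2 * Dseq d n.+2 =
  - Phi d + g n.+1 * Dseq d n - ('X - (beta d n.+1)%:P) * Cseq d n.+1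
  + ('X - (beta d n.+1)%:P) ^+ 2 * Dseq d n.+1.
Proof.
have [_ _ _ _ g_neq0] := P_rec.
rewrite /Cseq /Dseq [CDD d n.+2]/=.
rewrite [CDD d n.+1]/=; case: (CDD d n) => [[Cn Dn] Dm1] /=.
by rewrite !mul_polyC scalerA mulfV ?scale1r.
Qed.

(* The second and fourth equations are the first and third at index n - 1,
   where the recurrence trades P (n-1) and Q (n-1) for P (n+1) and Q (n+1). *)
Lemma structure_relations (n : nat) :
  [/\ Phi d * (P n.+1)^`() =
        (Cmean n.+1 - C0 d) * P n.+1 - g n.+1 * Dseq d n.+1 * P n
        + B0 d * Q n.+1,
      Phi d * (P n)^`() =
        - (Cmean n.+1 * P n) + Dseq d n * P n.+1 + B0 d * Q n,
      Phi d * (Q n.+1)^`() =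
        Cmean n.+1 * Q n.+1 - g n.+1 * Dseq d n.+1 * Q n
        - D0 d * P n.+1
    & Phi d * (Q n)^`() =
        - ((Cmean n.+1 - C0 d) * Q n) + Dseq d n * Q n.+1 - D0 d * P n].
Proof.
have [P0 P1 PSS _ _] := P_rec.
elim: n => [|n [IH1 IH2 IH3 IH4]].
  (* With Q_0 = 0 and Q_1 = 1, the first relation amounts to the formula for D_1, the second and
     third to [Cmean 1] = (x - beta_0) D_0. *)
  rewrite P0 P1 CmeanS Cmean0 gamma_Dseq1 /assoc /= -[Dseq d 0]/(D0 d).
  by rewrite !derivE; split; ring.
have QSS := assocSS (beta d) (gamma d) n.
have dP : (P n.+2)^`() = P n.+1 + ('X - (beta d n.+1)%:P) * (P n.+1)^`()
                         - g n.+1 * (P n)^`().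
  by rewrite PSS !derivE -mul_polyC; ring.
have dQ : (Q n.+2)^`() = Q n.+1 + ('X - (beta d n.+1)%:P) * (Q n.+1)^`()
                         - g n.+1 * (Q n)^`().
  by rewrite QSS !derivE -mul_polyC; ring.
have PSS' := PSS n; rewrite -mul_polyC in PSS'.
rewrite -mul_polyC in QSS.
(* Phi stays attached to each derivative, so that the induction hypotheses apply without dividing by
   Phi. *)
have dP2 : Phi d * (P n.+2)^`() = Phi d * P n.+1
   + ('X - (beta d n.+1)%:P) * (Phi d * (P n.+1)^`())
   - g n.+1 * (Phi d * (P n)^`()) by rewrite dP; ring.
have dQ2 : Phi d * (Q n.+2)^`() = Phi d * Q n.+1
   + ('X - (beta d n.+1)%:P) * (Phi d * (Q n.+1)^`())
   - g n.+1 * (Phi d * (Q n)^`()) by rewrite dQ; ring.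
rewrite dP2 dQ2 IH1 IH2 IH3 IH4 gamma_DseqSS.
rewrite (CmeanS n.+1) (Cseq_Cmean n.+1) PSS' QSS.
by split; ring.
Qed.


(** * Halves and quarters absorbed into [Cmean] *)

Lemma half_sum (n : nat) (p : {poly K}) :
  2^-1 *: ((Cseq d n + C0 d) * p) = Cmean n * p.
Proof. by rewrite scalerAl. Qed.

Lemma half_diff (n : nat) (p : {poly K}) :
  2^-1 *: ((Cseq d n - C0 d) * p) = (Cmean n - C0 d) * p.
Proof. by rewrite -[RHS]scale_half_double Cseq_Cmean; congr (_ *: _); ring. Qed.

Lemma M01E (n : nat) : M01 d n = C0 d - Cmean n.+1.
Proof. by rewrite /M01 -[Cseq _ _ - _]mulr1 half_diff mulr1 opprB. Qed.

Lemma half_deriv_sum (n : nat) : 2^-1 *: (Cseq d n + C0 d)^`() = (Cmean n)^`().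
Proof. by rewrite -derivZ. Qed.

Lemma quarter_sqr_sum (n : nat) : 4^-1 *: (Cseq d n + C0 d) ^+ 2 = Cmean n ^+ 2.
Proof. by rewrite /Cmean exprZn exprVn -natrX. Qed.

(** The structure relations send Phi d/dx of [Q n], [Q n.+1] and [P n] back into their span, up to
    multiples of [P n.+1], which are gathered on the left. The three coefficients on the right give
    the step from k to k + 1 for G_(0,k), G_(1,k) and H_k. *)
Lemma Phi_deriv_combination {n : nat} {F G0 G1 H : {poly K}} :
  F = G0 * Q n + G1 * Q n.+1 + H * P n ->
  Phi d * F^`() + (D0 d * G1 - Dseq d n * H) * P n.+1 =
    (Phi d * G0^`() - (Cmean n.+1 - C0 d) * G0 + B0 d * H
      - g n.+1 * Dseq d n.+1 * G1) * Q n
    + (Phi d * G1^`() + Cmean n.+1 * G1 + Dseq d n * G0) * Q n.+1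
    + (Phi d * H^`() - Cmean n.+1 * H - D0 d * G0) * P n.
Proof.
move=> ->; have [_ dP dQ1 dQ] := structure_relations n.
have -> : Phi d * (G0 * Q n + G1 * Q n.+1 + H * P n)^`() =
    Phi d * G0^`() * Q n + Phi d * G1^`() * Q n.+1 + Phi d * H^`() * P n
    + G0 * (Phi d * (Q n)^`()) + G1 * (Phi d * (Q n.+1)^`())
    + H * (Phi d * (P n)^`()) by rewrite !derivE; ring.
by rewrite dP dQ dQ1; ring.
Qed.

Lemma relation1 (n : nat) :
  Phi d * (P n.+1)^`() + M01 d n * P n.+1 =
  G01 K * Q n + G11 d * Q n.+1 + H1 d n * P n.
Proof.
have [-> _ _ _] := structure_relations n.
by rewrite M01E /G01 /G11 /H1 -mul_polyC; ring.
Qed.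

(** For k = 2 and 3 the closed formulas are checked against the recursion of
    [Phi_deriv_combination]; for k = 4 the definitions are that recursion up to notation. *)
Lemma G02_rec (n : nat) :
  G02 d n = Phi d * (G01 K)^`() - (Cmean n.+1 - C0 d) * G01 K + B0 d * H1 d n
    - g n.+1 * Dseq d n.+1 * G11 d.
Proof.
rewrite /G02 /G01 /G11 /H1 derivE.
by rewrite -!mul_polyC polyCM rmorph_nat; ring.
Qed.

Lemma G12_rec (n : nat) :
  G12 d n = Phi d * (G11 d)^`() + Cmean n.+1 * G11 d + Dseq d n * G01 K.
Proof. by rewrite /G12 /G01 /G11 half_sum; ring. Qed.

Lemma H2_rec (n : nat) :
  H2 d n = Phi d * (H1 d n)^`() - Cmean n.+1 * H1 d n - D0 d * G01 K.
Proof. by rewrite /H2 /H1 /G01 half_sum !derivE -!mul_polyC; ring. Qed.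

Lemma G03_rec (n : nat) :
  G03 d n = Phi d * (G02 d n)^`() - (Cmean n.+1 - C0 d) * G02 d n
    + B0 d * H2 d n - g n.+1 * Dseq d n.+1 * G12 d n.
Proof.
rewrite /G03 /G02 /G12 /H2 !half_sum Cseq_Cmean !derivE.
by rewrite -!mul_polyC !polyCM !rmorph_nat; ring.
Qed.

(** Since G_(1,2) = (Phi d/dx + Cmean) B_0, the first two terms on the right are (Phi d/dx +
    Cmean)^2 B_0; the last gives the term in D_n D_(n+1). *)
Lemma G13_rec (n : nat) :
  G13 d n = Phi d * (G12 d n)^`() + Cmean n.+1 * G12 d n + Dseq d n * G02 d n.
Proof.
rewrite /G13 /G12 /G02 quarter_sqr_sum half_sum.
rewrite [2^-1 *: (Phi d * _)]scalerAr half_deriv_sum Cseq_Cmean !derivE.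
by rewrite -!mul_polyC !polyCM !rmorph_nat; ring.
Qed.

Lemma H3_rec (n : nat) :
  H3 d n = Phi d * (H2 d n)^`() - Cmean n.+1 * H2 d n - D0 d * G02 d n.
Proof.
rewrite /H3 /H2 /G02 quarter_sqr_sum half_sum.
rewrite [2^-1 *: (_^`() * _)]scalerAl half_deriv_sum Cseq_Cmean !derivE.
by rewrite -!mul_polyC !polyCM !rmorph_nat; ring.
Qed.

Lemma G04_rec (n : nat) :
  G04 d n = Phi d * (G03 d n)^`() - (Cmean n.+1 - C0 d) * G03 d n
    + B0 d * H3 d n - g n.+1 * Dseq d n.+1 * G13 d n.
Proof. by rewrite /G04 half_diff -mul_polyC; ring. Qed.

Lemma G14_rec (n : nat) :
  G14 d n = Phi d * (G13 d n)^`() + Cmean n.+1 * G13 d n + Dseq d n * G03 d n.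
Proof. by rewrite /G14 half_sum; ring. Qed.

Lemma H4_rec (n : nat) :
  H4 d n = Phi d * (H3 d n)^`() - Cmean n.+1 * H3 d n - D0 d * G03 d n.
Proof. by rewrite /H4 half_sum; ring. Qed.

Lemma relation2 (n : nat) :
  Phi d ^+ 2 * (P n.+1)^`(2) + M12 d n * (P n.+1)^`() + M02 d n * P n.+1 =
  G02 d n * Q n + G12 d n * Q n.+1 + H2 d n * P n.
Proof.
rewrite G02_rec G12_rec H2_rec -(Phi_deriv_combination (relation1 n)).
(* The leftover coefficient D_0 G_(1,1) - D_n H_1 of [P n.+1] is the part B_0 D_0 + gamma_(n+1) D_n
   D_(n+1) of [M02]. *)
by rewrite /M12 /M02 /G11 /H1 !derivE -!mul_polyC /=; ring.
Qed.

Lemma relation3 (n : nat) :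
  Phi d ^+ 3 * (P n.+1)^`(3) + M23 d n * (P n.+1)^`(2)
    + M13 d n * (P n.+1)^`() + M03 d n * P n.+1 =
  G03 d n * Q n + G13 d n * Q n.+1 + H3 d n * P n.
Proof.
rewrite G03_rec G13_rec H3_rec -(Phi_deriv_combination (relation2 n)).
by rewrite /M23 /M13 /M03 !derivE -!mul_polyC rmorph_nat /=; ring.
Qed.

Lemma relation4 (n : nat) :
  Phi d ^+ 4 * (P n.+1)^`(4) + M34 d n * (P n.+1)^`(3)
    + M24 d n * (P n.+1)^`(2) + M14 d n * (P n.+1)^`() + M04 d n * P n.+1 =
  G04 d n * Q n + G14 d n * Q n.+1 + H4 d n * P n.
Proof.
rewrite G04_rec G14_rec H4_rec -(Phi_deriv_combination (relation3 n)).
by rewrite /M34 /M24 /M14 /M04 !derivE -!mul_polyC rmorph_nat /=; ring.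
Qed.

Lemma fourth_order_equation (n : nat) :
  odeA d n * (P n.+1)^`(4) + odeB d n * (P n.+1)^`(3)
  + odeC d n * (P n.+1)^`(2) + odeD d n * (P n.+1)^`()
  + odeE d n * P n.+1 = 0.
Proof.
transitivity
  (Delta4 d n * (G04 d n * Q n + G14 d n * Q n.+1 + H4 d n * P n)
   - Delta3 d n * (G03 d n * Q n + G13 d n * Q n.+1 + H3 d n * P n)
   + Delta2 d n * (G02 d n * Q n + G12 d n * Q n.+1 + H2 d n * P n)
   - Delta1 d n * (G01 K * Q n + G11 d * Q n.+1 + H1 d n * P n)).
  rewrite -relation1 -relation2 -relation3 -relation4.
  by rewrite /odeA /odeB /odeC /odeD /odeE; ring.
(* The coefficients of [Q n], [Q n.+1] and [P n] are 4 x 4 determinants with a repeated column,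
   expanded along that column. *)
by rewrite /Delta4 /Delta3 /Delta2 /Delta1; ring.
Qed.

End StructureRelation.

Theorem theorem5 (R : realType) (u : {scalar {poly R[i]}})
    (P : nat -> {poly R[i]}) (beta gamma : nat -> R[i])
    (Phi B C D : {poly R[i]})
    (u_normalized : u 1 = 1)
    (P_MOPS : is_MOPS u P)
    (P_rec : recurrence_coefs P beta gamma)
    (Phi_monic : Phi \is monic)
    (u_LH : stieltjes_riccati u Phi B C D) :
  forall n : nat,
    let d := LHData Phi B C D beta gamma in
    odeA d n * (P n.+1)^`(4) + odeB d n * (P n.+1)^`(3)
    + odeC d n * (P n.+1)^`(2) + odeD d n * (P n.+1)^`()
    + odeE d n * P n.+1 = 0.
Proof.
move=> n d; apply: fourth_order_equation; last exact: P_rec.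
by rewrite pnatr_eq0.
Qed.
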